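(* Let $T$ be a temporal graph, $M$ a temporal motif, $\delta$ a time span, $c>0$ an integer window-size parameter, and let $C_M$ be the number of $\delta$-instances of $M$ in $T$. Let $s$ be a uniformly random shift, $Y_s$ the corresponding weighted count vector, $q_j$ the sampling probabilities, $Q_j$ the sampling indicators, and $$Z=\sum_j Q_j\frac{Y_{s,j}}{q_j}.$$ Then $Z$ is an unbiased estimator for the number of motif instances, i.e. $\mathbb{E}[Z]=C_M$.
   Context: A temporal graph $T$ on a node set $V$ is a collection of tuples (directed temporal edges) $(u_i,v_i,t_i)$, $i=1,\dots,m$, with $u_i,v_i\in V$ and timestamps $t_i\in\mathbb{R}$; the timestamps are assumed to be unique and, without loss of generality, normalized to start at $0$. A temporal motif $M$ is a directed multigraph with an ordering on its edges, written as the ordered edge sequence $(u_1,v_1),\dots,(u_l,v_l)$. A $\delta$-instance of $M$ in $T$ is a time-ordered sequence $(w_1,x_1,t_1),\dots,(w_l,x_l,t_l)$, $t_1<\dots<t_l$, of $l$ unique temporal edges of $T$ such that there is a bijection $f$ from the nodes occurring in the sequence to the nodes of $M$ with $f(w_i)=u_i$, $f(x_i)=v_i$ for all $i$, and $t_l-t_1\le\delta$. The duration of an instance $M'$ is $\Delta(M')=t_l-t_1$. The shift $s$ is a random integer drawn uniformly from $\{-c\delta+1,\dots,0\}$, where $c>0$ is an integer. Set $I_j=[s+(j-1)c\delta,\; s+j\cdot c\delta-1]$ for $j=1,2,\dots$ and $\mathcal{I}_s=\{I_j : j=1,2,\dots\}$. For each $\delta$-instance $M'$ of $M$ in $T$ put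 $p_{M'}=1-\frac{\Delta(M')}{c\delta}$, which is stated to be the probability, over the random choice of $s$, that $M'$ is completely contained within an interval in $\mathcal{I}_s$. Let $X_{M'}(I)$ be the indicator random variable that equals $1$ if $M'$ is completely contained in the interval $I$ and $0$ otherwise. The vector $Y_s$ has coordinates $Y_{s,j}=\sum_{M'}\frac{1}{p_{M'}}X_{M'}(I_j)$, the sum being over the $\delta$-instances $M'$ of $M$ in $T$. Each interval $I_j\in\mathcal{I}_s$ is sampled independently with some probability $q_j$ (the $q_j$ are based on simple statistics of the intervals and do not necessarily sum to $1$), and $Q_j$ is the indicator random variable that equals $1$ if $I_j$ is sampled and $0$ otherwise.
   Formalization: All timestamps and the window length cδ are assumed to be integers, and p_{M'} is assumed nonzero for every δ-instance M'; with non-integer timestamps an instance can fall in the gap between consecutive windows and the claim fails. q_j is assumed nonzero wherever Y_{s,j} is nonzero. *)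

(* Defs.v *)
From HB Require Import structures.
From mathcomp Require Import all_boot all_order all_algebra finmap.
From mathcomp Require Import all_classical all_reals all_analysis.
Set Implicit Arguments.
Unset Strict Implicit.
Unset Printing Implicit Defensive.
Import Order.TTheory GRing.Theory Num.Theory.
Import numFieldNormedType.Exports.
Local Open Scope classical_set_scope.
Local Open Scope ring_scope.

Section TemporalGraphs.
Variables (R : realType) (V : choiceType).

Definition src (e : V * V * R) : V := e.1.1.
Definition dst (e : V * V * R) : V := e.1.2.
Definition time (e : V * V * R) : R := e.2.

Record temporal_graph := TemporalGraph {
  tedges :> {fset V * V * R};
  time_inj : {in tedges &, injective time};
  time_ge0 : forall e, e \in tedges -> 0 <= time e;
  time_start : tedges != fset0 -> exists2 e, e \in tedges & time e = 0 }.

Definition integer_timestamps (T : temporal_graph) :=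
  forall e, e \in tedges T -> time e \is a Num.int.

End TemporalGraphs.

(* A motif has at least one edge: [motif W n] consists of the motifs with
   l = n.+1 edges. Its nodes are the endpoints of its edges. *)
Definition motif (W : choiceType) (n : nat) := n.+1.-tuple (W * W).

Section Instances.
Variables (R : realType) (V W : choiceType) (n : nat).
Variables (T : temporal_graph R V) (M : motif W n).
Implicit Types (e : n.+1.-tuple (tedges T)) (delta : R) (c : nat).

Definition tedge e (i : 'I_n.+1) : V * V * R := val (tnth e i).

Definition duration e : R := time (tedge e ord_max) - time (tedge e ord0).

Definition sequence_nodes e : set V :=
  [set v | exists i, v = src (tedge e i) \/ v = dst (tedge e i)].

Definition motif_nodes : set W :=
  [set u | exists i, u = (tnth M i).1 \/ u = (tnth M i).2].

(* The strict increase of the timestamps also makes the edges distinct. *)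
Definition is_instance delta e : Prop :=
  [/\ forall i j : 'I_n.+1, (i < j)%N ->
        time (tedge e i) < time (tedge e j),
      exists2 f : V -> W, set_bij (sequence_nodes e) motif_nodes f &
        forall i, f (src (tedge e i)) = (tnth M i).1 /\
                  f (dst (tedge e i)) = (tnth M i).2
    & duration e <= delta].

Definition instance_count delta : nat :=
  #|[set e : n.+1.-tuple (tedges T) | `[< is_instance delta e >]]%SET|.

Definition containment_prob delta c e : R := 1 - duration e / (c%:R * delta).

(* The intervals are numbered j = 1, 2, ... *)
Definition window delta c (s : int) (j : nat) : set R :=
  `[s%:~R + (j%:R - 1) * (c%:R * delta), s%:~R + j%:R * (c%:R * delta) - 1].

Definition contained e (I : set R) : Prop := forall i, I (time (tedge e i)).

Definition weighted_count delta c (s : int) (j : nat) : R :=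
  \sum_(e : n.+1.-tuple (tedges T) | `[< is_instance delta e >])
    (containment_prob delta c e)^-1 *
    (`[< contained e (window delta c s j) >])%:R.

End Instances.

Definition shift_range (R : realType) (delta : R) (c : nat) : set int :=
  [set s | - (c%:R * delta) + 1 <= (s%:~R : R) <= 0].

Section Sampling.
Context d (Omega : measurableType d) (R : realType) (P : probability Omega R).

(* When c * delta is a positive integer, [shift_range delta c] has exactly
   c * delta elements. *)
Definition uniform_shift (delta : R) (c : nat) (S : Omega -> int) : Prop :=
  (forall s, measurable (S @^-1` [set s])) /\
  (forall s, P (S @^-1` [set s]) =
     (if `[< shift_range delta c s >] then (c%:R * delta)^-1 else 0)%:E).

(* [A j] is the event that the j-th interval is sampled. The sampling
   probabilities [q s j] may depend on the intervals, hence on the shift s: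
   conditionally on S = s, the events A 1, A 2, ... are mutually independent
   with probabilities q s 1, q s 2, ... *)
Definition independent_sampling (delta : R) (c : nat) (S : Omega -> int)
    (q : int -> nat -> R) (A : nat -> set Omega) : Prop :=
  (forall j, (1 <= j)%N -> measurable (A j)) /\
  (forall s, shift_range delta c s ->
   forall J : {fset nat}, (forall j, j \in J -> (1 <= j)%N) ->
     P (S @^-1` [set s] `&` \bigcap_(j in [set` J]) A j) =
     (P (S @^-1` [set s]) * (\prod_(j <- J) q s j)%:E)%E).

End Sampling.

Definition estimator (Omega : Type) (R : realType) (V W : choiceType) (n : nat)
    (T : temporal_graph R V) (M : motif W n) (delta : R) (c : nat)
    (S : Omega -> int) (q : int -> nat -> R) (A : nat -> set Omega)
    (w : Omega) : R :=
  limn (fun m => \sum_(1 <= j < m)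
    \1_(A j) w * (weighted_count T M delta c (S w) j / q (S w) j)).

(* Main.v *)
(* Write N = c delta. The window at position j for the shift -k starts at
   (j - 1) N - k, and jN - k - 1 runs once through the natural numbers as
   k < N and j >= 1 vary. An instance with times a <= ... <= b lies in the
   window exactly when b <= jN - k - 1 < a + N, hence for N - (b - a) = N p
   pairs (k, j); the weights 1 / p make the sum of all counts equal to N C_M.
   Sampling contributes a factor q_j, cancelled by 1 / q_j, and the uniform
   shift contributes the factor 1 / N. *)
Require Import Defs.
From HB Require Import structures.
From mathcomp Require Import all_boot all_order all_algebra finmap.
From mathcomp Require Import all_classical all_reals all_analysis.
From mathcomp Require Import measurable_realfun zify ring lra.
Set Implicit Arguments.
Unset Strict Implicit.
Unset Printing Implicit Defensive.
Import Order.TTheory GRing.Theory Num.Theory.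
Import numFieldNormedType.Exports.
Local Open Scope classical_set_scope.
Local Open Scope ring_scope.

(** * Sums over natural numbers *)

(** For fixed [j] the indices [j * N - k.+1] with [k < N] run backwards through the block from
    [(j - 1) * N] to [j * N - 1], and consecutive blocks tile the range below [m * N]. *)
Lemma sum_blocks (V : nmodType) (G : nat -> V) (N m : nat) :
  \sum_(k < N) \sum_(1 <= j < m.+1) G (j * N - k.+1)%N =
  \sum_(0 <= u < m * N) G u.
Proof.
rewrite exchange_big /= big_add1 /=.
elim: m => [|m IHm]; first by rewrite mul0n !big_geq.
have mN : (m * N <= m.+1 * N)%N by rewrite leq_mul2r leqnSn orbT.
rewrite big_nat_recr //= IHm (big_cat_nat (leq0n _) mN) /=.
congr (_ + _); rewrite (reindex_inj rev_ord_inj) /= -{1}(add0n (m * N)%N) big_addn.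
have -> : (m.+1 * N - m * N = N)%N by rewrite mulSn addnK.
rewrite big_mkord; apply: eq_bigr => i _.
congr G; have := ltn_ord i; lia.
Qed.

Lemma sum_nat_interval (a b B : nat) : (a <= B)%N ->
  (\sum_(0 <= u < B) (b <= u < a) = a - b)%N.
Proof.
elim: B a => [|B IHB] a aB; first by rewrite big_geq //; lia.
rewrite big_nat_recr //=.
have [aB'|Ba] := leqP a B; first by rewrite IHB //; lia.
(* The induction hypothesis does not cover the bound [a = B.+1], but below [B] the conditions
   [u < B.+1] and [u < B] agree. *)
have -> : a = B.+1 by lia.
rewrite (eq_big_nat _ _ (F2 := fun u => (b <= u < B)%N : nat)); last by move=> u /andP[_ uB]; congr nat_of_bool; lia.
by rewrite IHB //; lia.
Qed.

(** * Windows containing a given instance *)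

Section Windows.
Variables (R : realType) (V : choiceType) (n : nat) (T : temporal_graph R V).
Variables (delta : R) (c N : nat).
Hypothesis windowE : c%:R * delta = N%:R.
Implicit Types (e : n.+1.-tuple (tedges T)).

Lemma contained_endpoints e (x y : R) :
  (forall i j : 'I_n.+1, (i < j)%N -> time (tedge e i) < time (tedge e j)) ->
  contained e `[x, y] <->
  x <= time (tedge e ord0) /\ time (tedge e ord_max) <= y.
Proof.
move=> e_incr.
have e_le (i j : 'I_n.+1) : (i <= j)%N -> time (tedge e i) <= time (tedge e j).
  rewrite leq_eqVlt => /orP[/eqP/val_inj->//|/e_incr/ltW//].
split=> [e_in|[xe ey] i].
  have := e_in ord0; have := e_in ord_max.
  by rewrite /= !in_itv /= => /andP[_ ->] /andP[-> _].
rewrite /= in_itv /= (le_trans xe) ?e_le //=.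
by apply: le_trans ey; rewrite e_le // -ltnS.
Qed.

(** With [u = j * N - k.+1], the window has right endpoint [u], which must be at least [b], and left
    endpoint [u + 1 - N], which must be at most [a]. *)
Lemma contained_windowE e (a b k j : nat) :
  (forall i j : 'I_n.+1, (i < j)%N -> time (tedge e i) < time (tedge e j)) ->
  time (tedge e ord0) = a%:R -> time (tedge e ord_max) = b%:R ->
  (k < N)%N -> (0 < j)%N ->
  `[< contained e (window delta c (- k%:Z) j) >] =
  (b <= j * N - k.+1 < a + N)%N.
Proof.
move=> e_incr ea eb kN j0.
(* Keeps the subtraction in [j * N - k.+1] from truncating. *)
have kjN : (k.+1 <= j * N)%N by apply: leq_trans kN _; rewrite leq_pmull.
have startE : ((- k%:Z)%:~R + (j%:R - 1) * N%:R <= a%:R :> R) =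
    (j * N <= a + N + k)%N.
  by rewrite -(ler_nat R) !natrD natrM mulrNz -pmulrn; apply/idP/idP; lra.
have stopE : (b%:R <= (- k%:Z)%:~R + j%:R * N%:R - 1 :> R) =
    (b + k.+1 <= j * N)%N.
  rewrite -(ler_nat R) natrD natrM mulrNz -pmulrn -natr1.
  by apply/idP/idP; lra.
apply/asboolP/idP.
all: rewrite /window windowE contained_endpoints // ea eb startE stopE; lia.
Qed.

(** The pairs [(k, j)] correspond to the right endpoints [u < m * N]; the bound on [m] ensures that
    no admissible [u < a + N] is cut off. *)
Lemma sum_contained e (a b m : nat) :
  (forall i j : 'I_n.+1, (i < j)%N -> time (tedge e i) < time (tedge e j)) ->
  time (tedge e ord0) = a%:R -> time (tedge e ord_max) = b%:R ->
  (a + N <= m * N)%N ->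
  (\sum_(k < N) \sum_(1 <= j < m.+1)
     `[< contained e (window delta c (- (k : nat)%:Z) j) >] = a + N - b)%N.
Proof.
move=> e_incr ea eb aNm.
rewrite -(sum_nat_interval b aNm) -(sum_blocks _ N m).
apply: eq_bigr => k _; apply: eq_big_nat => j /andP[j0 _].
by rewrite (contained_windowE e_incr ea eb).
Qed.

(** Since [N >= 1], the [j]-th window starts no earlier than [j - 1 - |s|]; from [j = K + 1 + |s|]
    on this is at least [K], past the first edge. Hence only finitely many windows matter for each
    shift. *)
Lemma contained_window_bound e (K : nat) (s : int) (j : nat) :
  (0 < N)%N -> time (tedge e ord0) < K%:R ->
  contained e (window delta c s j) -> (j < K.+1 + `|s|)%N.
Proof.
move=> N0 eK /(_ ord0); rewrite /window windowE /= in_itv /= => /andP[sj _].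
rewrite ltnNge; apply/negP => jK.
have s_ge : - `|s|%N%:R <= s%:~R :> R.
  by rewrite natr_absz -mulrNz ler_int; lia.
have jK' : K%:R + `|s|%N%:R <= j%:R - 1 :> R.
  by rewrite -(ler_nat R) natrD -natr1 in jK; lra.
have j1 : 0 <= j%:R - 1 :> R by apply: le_trans jK'; rewrite addr_ge0.
have : (j%:R - 1) * 1 <= (j%:R - 1) * N%:R :> R.
  by rewrite ler_wpM2l // ler1n.
by rewrite mulr1; lra.
Qed.

End Windows.

(** * Weighted counts and the finite form of the estimator *)

Section Counts.
Variables (R : realType) (V W : choiceType) (n : nat).
Variables (T : temporal_graph R V) (M : motif W n).
Variables (delta : R) (c N : nat).
Hypotheses (delta_gt0 : 0 < delta) (c_gt0 : (0 < c)%N) (N_gt0 : (0 < N)%N).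
Hypothesis windowE : c%:R * delta = N%:R.

(** The duration is at most [delta], and [delta <= c * delta] because [c >= 1]. The value 0 is
    possible when [c = 1] and the duration equals [delta], so nonvanishing is a separate hypothesis
    later. *)
Lemma instance_containment_prob_ge0 (e : n.+1.-tuple (tedges T)) :
  is_instance M delta e -> 0 <= containment_prob delta c e.
Proof.
case=> _ _ e_delta; rewrite /containment_prob subr_ge0.
rewrite ler_pdivrMr ?mul1r; last by rewrite mulr_gt0 // ltr0n.
by apply: le_trans e_delta _; rewrite ler_peMl ?ler1n // ltW.
Qed.

Lemma weighted_count_ge0 s j : 0 <= weighted_count T M delta c s j.
Proof.
apply: sumr_ge0 => e /asboolP e_inst.
by rewrite mulr_ge0 // invr_ge0 instance_containment_prob_ge0.
Qed.

Lemma weighted_count_eq0 (K : nat) s j :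
  (forall e : V * V * R, e \in tedges T -> time e < K%:R) ->
  (K.+1 + `|s| <= j)%N -> weighted_count T M delta c s j = 0.
Proof.
move=> TK Kj; apply: big1 => e _.
case: asboolP; last by rewrite mulr0.
move/(contained_window_bound windowE N_gt0 (TK _ (valP _))).
by rewrite ltnNge Kj.
Qed.

(* Every instance contributes [1 / p] for each of the [N - duration = N p]
   shifts under which it lies in a single window. *)
Lemma sum_weighted_count (K m : nat) :
  integer_timestamps T ->
  (forall e : n.+1.-tuple (tedges T),
     is_instance M delta e -> containment_prob delta c e != 0) ->
  (forall e : V * V * R, e \in tedges T -> time e < K%:R) ->
  (K + N <= m * N)%N ->
  \sum_(k < N) \sum_(1 <= j < m.+1)
     weighted_count T M delta c (- (k : nat)%:Z) j =
  N%:R * (instance_count T M delta)%:R.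
Proof.
move=> T_int p_neq0 TK KN.
under eq_bigr do rewrite exchange_big.
rewrite exchange_big /= /instance_count -sum1_card natr_sum mulr_sumr.
rewrite [RHS](eq_bigl (fun e => `[< is_instance M delta e >])); last first.
  by move=> e; rewrite inE.
apply: eq_bigr => e /asboolP e_inst; have [e_incr _ e_delta] := e_inst.
under eq_bigr do rewrite -mulr_sumr.
rewrite -mulr_sumr mulr1.
have time_nat i : exists a : nat, time (tedge e i) = a%:R.
  apply/natrP; rewrite natrEint T_int ?(valP (tnth e i)) //=.
  exact: (@time_ge0 _ _ T _ (valP (tnth e i))).
have [a ea] := time_nat ord0; have [b eb] := time_nat ord_max.
have aNm : (a + N <= m * N)%N.
  apply: leq_trans KN; rewrite leq_add2r -(ler_nat R) -ea ltW // TK //.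
  exact: (valP (tnth e ord0)).
under eq_bigr do rewrite -natr_sum.
rewrite -natr_sum (sum_contained windowE e_incr ea eb aNm).
have := p_neq0 _ e_inst; have := instance_containment_prob_ge0 e_inst.
have N0 : N%:R != 0 :> R by rewrite pnatr_eq0 -lt0n.
rewrite /containment_prob /duration windowE ea eb => p_ge0 p0.
(* Nonnegativity of [p] makes the natural number [a + N - b] a true difference, equal to [N * p]. *)
have bN : (b <= a + N)%N.
  rewrite -(ler_nat R) natrD -lerBlDl -subr_ge0.
  have -> : N%:R - (b%:R - a%:R) = N%:R * (1 - (b%:R - a%:R) / N%:R) :> R by field.
  by rewrite mulr_ge0.
rewrite natrB // natrD.
have -> : a%:R + N%:R - b%:R = N%:R * (1 - (b%:R - a%:R) / N%:R) :> R by field.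
by rewrite mulrCA mulVf ?mulr1.
Qed.

(** The partial sums are constant from [m] on because all later counts vanish, so the limit is a
    finite sum whose length may depend on [S w]. *)
Lemma estimatorE (K m : nat) (Omega : Type) (S : Omega -> int)
    (q : int -> nat -> R) (A : nat -> set Omega) (w : Omega) :
  (forall e : V * V * R, e \in tedges T -> time e < K%:R) ->
  (K.+1 + `|S w| <= m)%N ->
  estimator T M delta c S q A w =
  \sum_(1 <= j < m)
    \1_(A j) w * (weighted_count T M delta c (S w) j / q (S w) j).
Proof.
move=> TK Km; apply: lim_near_cst => //.
exists m => // m' /= mm'.
rewrite (@big_cat_nat _ _ _ m) ?(leq_trans _ Km) //=.
rewrite [X in _ + X]big_nat [X in _ + X]big1 ?addr0 // => j /andP[mj _].
by rewrite (@weighted_count_eq0 K) ?mul0r ?mulr0 // (leq_trans Km).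
Qed.

End Counts.

(** * Fibres of the shift and its joint law with the sampling *)

(** A preimage splits into countably many pieces, one per value of [S]. This handles the estimator,
    whose coefficients and number of terms change with the shift. *)
Lemma measurable_fun_fibers d d' (T : measurableType d)
    (U : measurableType d') (I : countType) (S : T -> I) (F : I -> T -> U) :
  (forall s, measurable (S @^-1` [set s])) ->
  (forall s, measurable_fun setT (F s)) ->
  measurable_fun setT (fun x => F (S x) x).
Proof.
move=> mS mF _ B mB; rewrite setTI.
have -> : (fun x => F (S x) x) @^-1` B =
    \bigcup_s (S @^-1` [set s] `&` F s @^-1` B).
  by apply/seteqP; split => [x /= Bx|x [s _ [/= <-]]//]; exists (S x).
apply: countable_bigcupT_measurable => [|s]; first exact: countableP.
by apply: measurableI => //; rewrite -[_ @^-1` _]setTI; apply: mF.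
Qed.

(** Injectivity of [pickle] leaves at most one fibre for each code [k], so the preimage is a
    countable union of null sets. It serves to discard the shifts outside the range. *)
Lemma negligible_fibers d (T : measurableType d) (R : realType)
    (mu : {measure set T -> \bar R}) (I : countType) (S : T -> I) (D : set I) :
  (forall s, measurable (S @^-1` [set s])) ->
  (forall s, D s -> mu (S @^-1` [set s]) = 0%E) ->
  mu.-negligible (S @^-1` D).
Proof.
move=> mS S0.
have -> : S @^-1` D =
    \bigcup_k \bigcup_(s in [set s | D s /\ choice.pickle s = k]) S @^-1` [set s].
  apply/seteqP; split => [x Dx|x [k _ [s [Ds _] /= ->]]//].
  by exists (choice.pickle (S x)) => //; exists (S x).
apply: negligible_bigcup => k.
have [[s [Ds sk]]|no_s] := pselect (exists s, D s /\ choice.pickle s = k); last first.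
  apply: (negligibleS (A := set0)); last exact: negligible_set0.
  by move=> x [s Ds _]; case: no_s; exists s.
apply: (negligibleS (A := S @^-1` [set s])).
  move=> x [t [_ tk] /= ->].
  by apply: (pcan_inj choice.pickleK); rewrite tk sk.
by apply/negligibleP => //; exact: S0.
Qed.

Lemma shift_rangeP (R : realType) (delta : R) (c N : nat) (s : int) :
  c%:R * delta = N%:R ->
  shift_range delta c s <-> exists2 k, (k < N)%N & s = - k%:Z.
Proof.
move=> windowE; rewrite /shift_range /= windowE.
have -> : - N%:R + 1 = (- N%:Z + 1)%:~R :> R by rewrite intrD mulrNz.
rewrite ler_int lerz0; split=> [/andP[Ns s0]|[k kN ->]]; last by apply/andP; lia.
by exists `|s|%N; lia.
Qed.

Lemma fset_strict_bound (R : realType) (I : choiceType) (X : {fset I})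
    (f : I -> R) : exists K : nat, forall e, e \in X -> f e < K%:R.
Proof.
exists (\max_(e <- X) (Num.truncn (f e)).+1)%N => e eX.
apply: lt_le_trans (truncnS_gt (f e)) _.
by rewrite ler_nat leq_bigmax_seq.
Qed.

(** By linearity, the expectation involves one shift and one sampled interval at a time; their joint
    probability is the case of a singleton [J]. *)
Lemma sampled_shift_prob d (Omega : measurableType d) (R : realType)
    (P : probability Omega R) (delta : R) (c : nat) (S : Omega -> int)
    (q : int -> nat -> R) (A : nat -> set Omega) (s : int) (j : nat) :
  uniform_shift P delta c S -> independent_sampling P delta c S q A ->
  shift_range delta c s -> (0 < j)%N ->
  P (S @^-1` [set s] `&` A j) = ((c%:R * delta)^-1 * q s j)%:E.
Proof.
move=> [_ S_prob] [_ A_indep] s_range j0.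
have := A_indep s s_range [fset j]%fset.
rewrite set_fset1 bigcap_set1 big_seq_fset1 S_prob asboolT // -EFinM.
by apply=> i; rewrite inE => /eqP ->.
Qed.

(** * Expectation of the estimator *)

Theorem theorem4p3 (d : measure_display) (Omega : measurableType d)
    (R : realType) (P : probability Omega R) (V W : choiceType) (n : nat)
    (T : temporal_graph R V) (M : motif W n) (delta : R) (c : nat)
    (S : Omega -> int) (q : int -> nat -> R) (A : nat -> set Omega)
    (delta_gt0 : 0 < delta) (c_gt0 : (0 < c)%N)
    (window_int : c%:R * delta \is a Num.int)
    (T_int : integer_timestamps T)
    (p_neq0 : forall e : n.+1.-tuple (tedges T),
       is_instance M delta e -> containment_prob delta c e != 0)
    (S_unif : uniform_shift P delta c S)
    (q_prob : forall s j, shift_range delta c s -> (1 <= j)%N ->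
       0 <= q s j <= 1)
    (q_neq0 : forall s j, shift_range delta c s -> (1 <= j)%N ->
       weighted_count T M delta c s j != 0 -> q s j != 0)
    (A_indep : independent_sampling P delta c S q A) :
  ('E_P[estimator T M delta c S q A] = (instance_count T M delta)%:R%:E)%E.
Proof.
have window_gt0 : 0 < c%:R * delta by rewrite mulr_gt0 // ltr0n.
have [N windowE] : exists N, c%:R * delta = N%:R.
  by apply/natrP; rewrite natrEint window_int ltW.
have N_gt0 : (0 < N)%N by rewrite -(ltr0n R) -windowE.
have [K TK] := fset_strict_bound (tedges T) (@time R V).
have [[S_meas S_prob] [A_meas _]] := (S_unif, A_indep).
have range_k (k : 'I_N) : shift_range delta c (- (k : nat)%:Z).
  by apply/(shift_rangeP _ windowE); exists k.
set Y := weighted_count T M delta c.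
(* The estimator with the shift frozen at [s], for every integer [s]: positions are written [j.+1],
   and counts beyond position [K + |s|] vanish. *)
pose F s w := \sum_(0 <= j < K + `|s|) \1_(A j.+1) w * (Y s j.+1 / q s j.+1).
pose B (k : 'I_N) j := S @^-1` [set - (k : nat)%:Z] `&` A j.+1.
pose y (k : 'I_N) j := Y (- (k : nat)%:Z) j.+1 / q (- (k : nat)%:Z) j.+1.
have B_meas k j : measurable (B k j) by apply: measurableI; auto.
have y_ge0 k j : 0 <= y k j.
  have /andP[q0 _] := q_prob _ j.+1 (range_k k) isT.
  by rewrite divr_ge0 // (weighted_count_ge0 _ _ delta_gt0).
have Z_meas : measurable_fun setT (estimator T M delta c S q A).
  rewrite (_ : estimator _ _ _ _ _ _ _ = fun w => F (S w) w).
    apply: measurable_fun_fibers => // s; apply: measurable_sum => j.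
    by apply: measurable_funM => //; apply: measurable_indic; exact: A_meas.
  apply/funext => w.
  by rewrite (estimatorE _ N_gt0 windowE _ _ TK (leqnn _)) big_add1.
have term_meas k j : measurable_fun setT (fun w => (\1_(B k j) w)%:E : \bar R).
  by apply/measurable_EFinP; exact: measurable_indic.
(* Shifts in the range satisfy [|s| < N], so the cutoff [K + N] serves all of them. The sum over [k]
   selects the actual shift through the indicator of [B k j]. *)
pose Z' w := (\sum_(k < N) \sum_(0 <= j < K + N) (y k j)%:E * (\1_(B k j) w)%:E)%E.
(* The two can differ only where the shift leaves its range, which is a null event. *)
have ZZ' : ae_eq P setT (EFin \o estimator T M delta c S q A) Z'.
  apply: (negligibleS (A := S @^-1` (~` shift_range delta c))); last first.
    apply: negligible_fibers => // s s_out.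
    by have := S_prob s; rewrite asboolF.
  move=> w /= Zw Sw_range; apply: Zw => _.
  have [k kN Sw] := (shift_rangeP (S w) windowE).1 Sw_range.
  rewrite /Z' (bigD1 (Ordinal kN)) //= [X in (_ + X)%E]big1 ?adde0; last first.
    move=> i ik; apply: big1 => j _.
    rewrite indicE memNset ?mule0 //= => -[/= Swi _].
    case/eqP: ik; apply: val_inj => /=; move: Swi; rewrite Sw; lia.
  rewrite (estimatorE _ N_gt0 windowE _ _ TK (_ : _ <= (K + N).+1)%N); last first.
    by rewrite Sw; lia.
  rewrite big_add1 /= -sumEFin; apply: eq_bigr => j _.
  rewrite -EFinM mulrC Sw; congr (_ * _)%:E.
  by rewrite !indicE /B in_setI [X in X && _]mem_set.
rewrite unlock (ae_eq_integral Z') //; first last.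
- apply: emeasurable_sum => k; apply: emeasurable_sum => j.
  by apply: emeasurable_funM.
- exact/measurable_EFinP.
rewrite ge0_integral_sum //; first last.
- move=> k w _; apply: sume_ge0 => j _; by rewrite mule_ge0 // lee_fin.
- by move=> k; apply: emeasurable_sum => j; apply: emeasurable_funM.
(* The event [B k j] has probability [q / (c * delta)], and its factor [q] cancels the denominator
   of [y k j]. *)
transitivity (\sum_(k < N) \sum_(0 <= j < K + N)
    ((c%:R * delta)^-1 * Y (- (k : nat)%:Z) j.+1)%:E)%E.
  apply: eq_bigr => k _; rewrite ge0_integral_sum //; first last.
  - by move=> j w _; rewrite mule_ge0 // lee_fin.
  - by move=> j; apply: emeasurable_funM.
  apply: eq_bigr => j _; rewrite ge0_integralZl ?lee_fin //.
  rewrite integral_indic // setIT.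
  rewrite [X in (_ * X)%E](sampled_shift_prob S_unif A_indep (range_k k)) //.
  rewrite -EFinM.
  congr EFin; rewrite /y /Y mulrCA; congr (_ * _).
  (* Where the count is 0, [q] may be 0 as well, but then both sides vanish; elsewhere [q_neq0]
     allows the cancellation. *)
  have [->|Y0] := eqVneq (weighted_count T M delta c (- (k : nat)%:Z) j.+1) 0.
    by rewrite !mul0r.
  by rewrite divfK // q_neq0.
under eq_bigr do rewrite sumEFin.
rewrite sumEFin; congr EFin.
under eq_bigr do rewrite -mulr_sumr.
rewrite -mulr_sumr windowE.
(* The cutoff [m = K + N] is admissible for [sum_weighted_count] because [N >= 1]. *)
have -> : \sum_(k < N) \sum_(0 <= j < K + N) Y (- (k : nat)%:Z) j.+1 =
    N%:R * (instance_count T M delta)%:R.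
  rewrite -(sum_weighted_count (m := K + N) delta_gt0 c_gt0 N_gt0 windowE T_int p_neq0 TK).
    by apply: eq_bigr => k _; rewrite big_add1.
  by rewrite mulnDl leq_add // leq_pmulr.
by rewrite mulKf // pnatr_eq0 -lt0n.
Qed.
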